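(* Let $A$ be a rooted directed tree and let $\lambda=(\lambda_u)_{u\in A}$ be a weight such that the induced weighted backward shift $B_\lambda$ is bounded on $c_0(A)$. The following are equivalent. (i) $B_\lambda$ is hypercyclic. (ii) $B_\lambda$ supports a hypercyclic algebra. (iii) $B_\lambda$ supports a dense, countably generated, free hypercyclic algebra.
   Context: All scalars are complex. A directed tree is a connected directed graph $(A,E)$ with countable vertex set $A$ and edge set $E\subset\{(a,b)\in A\times A: a\ne b\}$, having no cycles, and such that each vertex $b$ has at most one parent, i.e. a vertex $a$ with $(a,b)\in E$. There is at most one vertex without a parent, called the root; the tree is rooted if it has a root. $\mathrm{Chi}(v)$ is the set of children of $v$ (vertices whose parent is $v$). All trees are assumed leafless: every vertex has at least one child (possibly infinitely many). A weight is a family $\lambda=(\lambda_v)_{v\in A}$ of non-zero scalars. The weighted backward shift is $(B_\lambda f)(v)=\sum_{u\in\mathrm{Chi}(v)}\lambda_uf(u)$ for $v\in A$. $c_0(A)$ is the space of $f\in\mathbb{C}^A$ such that for every $\varepsilon>0$ there is a finite $F\subset A$ with $|f(v)|<\varepsilon$ for all $v\in A\setminus F$, with the sup norm; it is a Banach algebra for the coordinatewise product $(fg)(v)=f(v)g(v)$. $HC(T)$ is the set of hypercyclic vectors of $T$, i.e. vectors $x$ whose orbit $\{T^nx:n\ge0\}$ is dense; $T$ is hypercyclic if $HC(T)\neq\varnothing$. A hypercyclic algebra for $T$ is a subalgebra, not $\{0\}$, contained in $HC(T)\cup\{0\}$. It is dense if it is dense in the whole space, and countably generated and free if it is generated by a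 countably infinite set $G$ that is algebraically independent: $P(g_1,\dots,g_d)\ne0$ for all $d\geq 1$, distinct $g_1,\dots,g_d\in G$ and every non-zero polynomial $P$ in $d$ commuting variables without constant term. *)

(* Defs.v *)
From HB Require Import structures.
From mathcomp Require Import all_boot all_order all_algebra.
From mathcomp Require Import finmap complex.
From mathcomp Require Import all_classical all_reals all_analysis.
From mathcomp Require Import summability.
(* The notations of mpoly clash with those of analysis. *)
From mathcomp Require Import -(notations) mpoly.

Set Implicit Arguments.
Unset Strict Implicit.
Unset Printing Implicit Defensive.

Import Order.TTheory GRing.Theory Num.Theory.
Import numFieldNormedType.Exports.

Local Open Scope classical_set_scope.
Local Open Scope ring_scope.
Local Open Scope complex_scope.

Section Trees.
Context {A : countType} (E : rel A).

(* [E a b] means that (a, b) is an edge, i.e. that a is the parent of b.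
   Connectedness refers to undirected paths.  Cycles are directed: the closed
   walks of [E], since [cycle E [::]] holds trivially.  As every vertex has at
   most one parent, the underlying undirected graph has no cycle either. *)
Record directed_tree : Prop := DirectedTree {
  edge_irr : forall a, ~~ E a a;
  tree_connected : forall a b,
    exists p : seq A, path (fun x y => E x y || E y x) a p /\ last a p = b;
  tree_acyclic : forall c : seq A, cycle E c -> c = [::];
  parent_unique : forall a a' b, E a b -> E a' b -> a = a'
}.

Definition rooted := exists r, forall a, ~~ E a r.

Definition leafless := forall v, exists u, E v u.

Definition Chi (v : A) := {u : A | E v u}.

End Trees.

Section CZero.
Context (R : realType) (A : choiceType).

Definition vanishing (f : A -> R[i]) :=
  forall e : R[i], 0 < e ->
    exists2 F : set A, finite_set F & forall v, ~ F v -> `|f v| < e.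

Definition c0_pred : {pred A -> R[i]} := mem [set f | vanishing f].

Lemma vanishing_submod : submod_closed c0_pred.
Proof.
split=> [|a f g]; rewrite !inE/=.
  by move=> e e0; exists set0 => // v _; rewrite normr0.
move=> hf hg e e0.
have a0 : 0 < `|a| + 1 by rewrite ltr_wpDl.
have [|F finF hF] := hf (e / 2%:R / (`|a| + 1)); first by rewrite !divr_gt0.
have [|G finG hG] := hg (e / 2%:R); first by rewrite divr_gt0.
exists (F `|` G); first by rewrite finite_setU.
move=> v /not_orP[/hF fv /hG gv].
apply: le_lt_trans (ler_normD _ _) _; rewrite normrM [ltRHS]splitr.
apply: ler_ltD gv; apply: (@le_trans _ _ ((`|a| + 1) * `|f v|)).
  by rewrite ler_wpM2r// lerDl.
by rewrite mulrC -ler_pdivlMr// ltW.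
Qed.

HB.instance Definition _ :=
  GRing.isSubmodClosed.Build R[i] (A -> R[i]) c0_pred vanishing_submod.

Record c0 := C0 { c0_fun :> A -> R[i]; _ : c0_fun \in c0_pred }.

HB.instance Definition _ := [isSub for c0_fun].
HB.instance Definition _ := [Choice of c0 by <:].
HB.instance Definition _ := [SubChoice_isSubLmodule of c0 by <:].

Lemma c0P (f : c0) : vanishing f.
Proof. by case: f => f /=; rewrite inE. Qed.

Definition supnorm (f : c0) : R := sup (range (fun v => complex.Re `|f v|)).

Lemma Re_normC (z : R[i]) : (complex.Re `|z|)%:C = `|z|.
Proof. by rewrite normc_def. Qed.

Lemma Re_normc_ge0 (z : R[i]) : 0 <= complex.Re `|z|.
Proof. by rewrite -lecR Re_normC; exact: normr_ge0. Qed.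

Lemma c0_bounded (f : c0) : has_ubound (range (fun v => complex.Re `|f v|)).
Proof.
have [F finF hF] := c0P f ltr01.
exists (1 + \sum_(v <- fset_set F) complex.Re `|f v|) => _ [v _ <-].
have [Fv|/hF fv] := pselect (F v).
  rewrite (big_fsetD1 v)/=; last by rewrite in_fset_set// inE.
  by rewrite addrCA lerDl addr_ge0 ?Re_normc_ge0// sumr_ge0// => *;
    exact: Re_normc_ge0.
apply: (@le_trans _ _ 1); last by rewrite lerDl sumr_ge0// => *;
  exact: Re_normc_ge0.
by rewrite -lecR Re_normC; exact: ltW.
Qed.

Lemma le_supnorm (f : c0) v : complex.Re `|f v| <= supnorm f.
Proof. by apply: ub_le_sup; [exact: c0_bounded | exists v]. Qed.

Lemma supnorm_le (f : c0) (M : R) :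
  0 <= M -> (forall v, complex.Re `|f v| <= M) -> supnorm f <= M.
Proof.
move=> M0 h; have [ne|ne] := eqVneq (range (fun v => complex.Re `|f v|)) set0.
  by rewrite /supnorm ne sup0.
by apply: ge_sup => [|_ [v _ <-]//]; exact/set0P.
Qed.

Lemma supnorm_ge0 (f : c0) : 0 <= supnorm f.
Proof.
have [e|/set0P[_ [v _ _]]] := eqVneq (range (fun v => complex.Re `|f v|)) set0.
  by rewrite /supnorm e sup0.
by apply: le_trans (le_supnorm f v); exact: Re_normc_ge0.
Qed.

Definition c0_norm (f : c0) : R[i] := (supnorm f)%:C.

Lemma c0_ler_normD f g : c0_norm (f + g) <= c0_norm f + c0_norm g.
Proof.
rewrite -rmorphD/= lecR; apply: supnorm_le => [|v].
  by rewrite addr_ge0// supnorm_ge0.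
have : complex.Re `|f v + g v| <= complex.Re `|f v| + complex.Re `|g v|.
  by rewrite -lecR rmorphD/= !Re_normC ler_normD.
by move=> /le_trans; apply; rewrite lerD// le_supnorm.
Qed.

Lemma supnormZ_le (l : R[i]) f : c0_norm (l *: f) <= `|l| * c0_norm f.
Proof.
rewrite -(Re_normC l) -rmorphM/= lecR; apply: supnorm_le => [|v].
  by rewrite mulr_ge0 ?supnorm_ge0 ?Re_normc_ge0.
rewrite -lecR Re_normC [_ v]/= normrM rmorphM/= Re_normC ler_wpM2l//.
by rewrite -Re_normC lecR le_supnorm.
Qed.

Lemma c0_normrZ (l : R[i]) f : c0_norm (l *: f) = `|l| * c0_norm f.
Proof.
have [->|l0] := eqVneq l 0.
  apply/eqP; rewrite eq_le supnormZ_le normr0 mul0r/= lecR.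
  exact: supnorm_ge0.
apply/eqP; rewrite eq_le supnormZ_le/= -ler_pdivlMl ?normr_gt0//.
by have := supnormZ_le l^-1 (l *: f); rewrite scalerA mulVf// scale1r normfV.
Qed.

Lemma c0_normr0_eq0 f : c0_norm f = 0 -> f = 0.
Proof.
move=> /complexI f0; apply/val_inj/funext => v /=.
apply/normr0_eq0; rewrite -Re_normC; congr (_%:C).
apply/eqP; rewrite eq_le -{1}f0 le_supnorm/= -lecR Re_normC.
exact: normr_ge0.
Qed.

HB.instance Definition _ := @Lmodule_isNormed.Build R[i] c0
  c0_norm c0_ler_normD c0_normrZ c0_normr0_eq0.

Lemma c0_normE (f : c0) : `|f| = (supnorm f)%:C.
Proof. by []. Qed.

Lemma c0_mul_subproof (f g : c0) : (fun v => f v * g v) \in c0_pred.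
Proof.
rewrite inE => e e0.
have [F finF hF] := c0P f e0; have [G finG hG] := c0P g ltr01.
exists (F `|` G); first by rewrite finite_setU.
move=> v /not_orP[/hF fv /hG gv]; rewrite normrM -[ltRHS]mulr1.
exact: ltr_pM.
Qed.

Definition c0_mul (f g : c0) : c0 := C0 (c0_mul_subproof f g).

End CZero.

Section Subalgebras.
Context {R : realType} {A : choiceType}.
Implicit Types (S G : set (c0 R A)).

(* c0 has no unit when A is infinite: subalgebras are non-unital. *)
Record subalgebra S : Prop := Subalgebra {
  subalg0 : S 0;
  subalgD : forall f g, S f -> S g -> S (f + g);
  subalgZ : forall (a : R[i]) f, S f -> S (a *: f);
  subalgM : forall f g, S f -> S g -> S (c0_mul f g)
}.

(* Since P has no constant term, P(g_1, ..., g_d) only involves coordinatewise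
   products, so it is computed by evaluating P at each vertex. *)
Definition algebraically_independent G :=
  forall d : nat, (0 < d)%N ->
  forall g : 'I_d -> c0 R A, injective g -> (forall i, G (g i)) ->
  forall P : mpoly d R[i],
    P != 0 -> mcoeff mnm0 P = 0 ->
    (fun v : A => meval (fun i => g i v) P) <> (fun=> 0).

Definition countably_generated_free S :=
  exists G, [/\ (G #= [set: nat])%card, algebraically_independent G &
                S = smallest subalgebra G].

End Subalgebras.

Definition hypercyclic_vectors {V : topologicalType} (T : V -> V) : set V :=
  [set x | dense (range (fun n => iter n T x))].

Definition hypercyclic {V : topologicalType} (T : V -> V) :=
  hypercyclic_vectors T !=set0.

Definition bounded_operator {K : numFieldType} {V : normedModType K}
  (T : V -> V) := exists M : K, forall x, `|T x| <= M * `|x|.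

Section Shifts.
Context {R : realType} {A : countType}.
Implicit Types (T : c0 R A -> c0 R A) (S : set (c0 R A)).

(* T is the operator on c0 induced by B_lambda: in particular the possibly
   infinite sums over Chi(v) are required to converge (unconditionally, as
   Chi(v) carries no order), and their values to define an element of c0. *)
Definition is_weighted_backward_shift (E : rel A) (lambda : A -> R[i]) T :=
  forall (f : c0 R A) (v : A),
    partial_sum (fun u : Chi E v => lambda (val u) * f (val u)) @ totally
      --> (T f v : R[i]^o).

Definition hypercyclic_algebra T S :=
  [/\ subalgebra S, S != [set 0] & S `<=` hypercyclic_vectors T `|` [set 0]].

End Shifts.

(* Main.v *)
Require Import Defs.
From HB Require Import structures.
From mathcomp Require Import all_boot all_order all_algebra.
From mathcomp Require Import finmap complex.
From mathcomp Require Import all_classical all_reals all_analysis.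
From mathcomp Require Import -(notations) mpoly.
From mathcomp Require Import summability.
From mathcomp Require Import ring lra.
Import Order.TTheory GRing.Theory Num.Theory.
Import numFieldNormedType.Exports.
Local Open Scope classical_set_scope.
Local Open Scope ring_scope.
Local Open Scope complex_scope.

(** Only one implication is not formal: hypercyclicity of the shift [B] must
produce a dense free hypercyclic algebra.

Growth.  If [x] is hypercyclic, then [B^n x] comes close to a large multiple of
the indicator of any finite set of vertices.  As [|x|] is fixed, the weights
from the [n]-th generation down to each of these vertices [v] must have a large
absolute sum [Lam v], and this already happens on finitely many descendants
([hypercyclic_growth]).

Blocks.  Let [y] be a finitely supported target and [w >= 1] an exponent.  For a
descendant [u] of [v] of weight [c u], let [h u] be a [w]-th root of
[y v * (|c u| / c u) / Lam v].  Then [B^n (h^w) = y], while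
[|h u| <= (|y| / Lam v)^(1/w)] is uniformly small.  Higher powers of [h] are
therefore negligible: [h^(w+j) = h^w h^j], so [B^n (h^(w+j))] is bounded by
[|y|] times a small number ([exists_block]).  It is the sum of the weights that
is large, not the weights themselves, so that a vertex may well have infinitely
many children with small weights.

Generators.  Blocks [h_k] are built one after the other, with disjoint supports
and along a list in which every triple (base [K], exponent [w], target [y])
occurs arbitrarily late; [h_k] is tiny with respect to the norms of the earlier
iterates ([block_sequence_exists]).  The generator [g_i] consists of the [i]-th
target followed by the powers [h_k^(K_k^i)] for [k >= i].  It is close to its
target when [i] is large, so the [g_i] are dense.

Polynomials.  A monomial with exponents [m_i] takes on the [k]-th block the value
[h_k^(sum_i m_i K^i)].  For [K] large these exponents are distinct for distinct
monomials of a given polynomial [P] (Kronecker substitution, [kron_inj]), so a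
single monomial [m0] of [P] has the lowest exponent.  Along those [k] whose triple
carries this [K] and this exponent, the earlier blocks are killed by [B^(n_k)], the
later ones are tiny, and the block [k] contributes [P_m0 y_k] up to a small
error ([orbit_target]).  Hence [P(g)] is hypercyclic whenever [P] is nonzero and
has no constant term ([poly_hypercyclic]); since a hypercyclic vector is nonzero,
this gives freeness too. *)

Set Implicit Arguments.
Unset Strict Implicit.
Unset Printing Implicit Defensive.

(** * The space of null families *)

Section C0.
Context {R : realType} {A : countType}.
Implicit Types (f g h : c0 R A) (s : seq A).

Lemma c0_eq f g : f =1 g -> f = g.
Proof. by move=> fg; apply/val_inj/funext. Qed.

Lemma c0_addE f g v : (f + g) v = f v + g v. Proof. by []. Qed.
Lemma c0_subE f g v : (f - g) v = f v - g v. Proof. by []. Qed.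
Lemma c0_scaleE (a : R[i]) f v : (a *: f) v = a * f v. Proof. by []. Qed.
Lemma c0_mulE f g v : c0_mul f g v = f v * g v. Proof. by []. Qed.

Lemma c0_sumE (I : Type) (r : seq I) (P : pred I) (F : I -> c0 R A) v :
  (\sum_(i <- r | P i) F i : c0 R A) v = \sum_(i <- r | P i) F i v.
Proof. exact: (big_morph (fun f : c0 R A => f v)). Qed.

Lemma c0_sumZE (I : Type) (r : seq I) (P : pred I) (c : I -> R[i])
    (F : I -> c0 R A) v :
  (\sum_(i <- r | P i) c i *: F i : c0 R A) v = \sum_(i <- r | P i) c i * F i v.
Proof. exact: c0_sumE. Qed.

Lemma normc_le_c0 f v : `|f v| <= `|f|.
Proof. by rewrite c0_normE -Re_normC lecR le_supnorm. Qed.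

Lemma c0_norm_le f (M : R[i]) :
  0 <= M -> (forall v, `|f v| <= M) -> `|f| <= M.
Proof.
move=> M0 fM; rewrite c0_normE -(RRe_real (ger0_real M0)) lecR.
apply: supnorm_le => [|v]; last first.
  by rewrite -lecR Re_normC RRe_real ?ger0_real.
by rewrite -lecR RRe_real ?ger0_real.
Qed.

Lemma indic_subproof u : (fun v => (v == u)%:R : R[i]) \in @c0_pred R A.
Proof.
rewrite inE => e e0; exists [set u]; first exact: finite_set1.
by move=> v /eqP/negPf ->; rewrite normr0.
Qed.

Definition c0_delta u : c0 R A := C0 (indic_subproof u).

Lemma c0_deltaE u v : c0_delta u v = (v == u)%:R.
Proof. by []. Qed.

Definition c0_restr s (F : A -> R[i]) : c0 R A :=
  \sum_(u <- undup s) F u *: c0_delta u.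

Lemma c0_restrE s (F : A -> R[i]) v :
  c0_restr s F v = if v \in s then F v else 0.
Proof.
rewrite c0_sumZE -mem_undup; case: ifPn => vs.
  rewrite (bigD1_seq v) ?undup_uniq//= eqxx mulr1 big1 ?addr0// => u uv.
  by rewrite eq_sym (negPf uv) mulr0.
rewrite big1_seq// => u /andP[_ us]; rewrite c0_deltaE.
have [vu|] := eqVneq v u; first by rewrite vu us in vs.
by rewrite mulr0.
Qed.

Lemma c0_restr_id s f : (forall v, v \notin s -> f v = 0) -> c0_restr s f = f.
Proof.
by move=> fs; apply: c0_eq => v; rewrite c0_restrE; case: ifPn => // /fs.
Qed.

Lemma c0_restr_approx f (e : R[i]) : 0 < e -> exists s, `|f - c0_restr s f| <= e.
Proof.
move=> e0; have [F /finite_seqP[s ->] Fs] := c0P f e0; exists s.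
apply: c0_norm_le => [|v]; first exact: ltW.
rewrite c0_subE c0_restrE.
case: ifPn => [|/negP vs]; first by rewrite subrr normr0 ltW.
by rewrite subr0 ltW// Fs.
Qed.

(** The exponent is [n.+1]: there is no power of exponent 0, as [c0] has no unit
in general. *)
Definition c0_pow f n := iter n (c0_mul f) f.

Lemma c0_powE f n v : c0_pow f n v = f v ^+ n.+1.
Proof.
elim: n => [|n IHn]; rewrite ?expr1//.
by rewrite [c0_pow _ _]iterS -/(c0_pow f n) c0_mulE IHn -exprS.
Qed.

Lemma c0_nontrivial u : c0_delta u != 0.
Proof.
apply/eqP => /(congr1 (fun f => f u)); rewrite c0_deltaE eqxx => /eqP.
by rewrite oner_eq0.
Qed.

Lemma c0_denseP (S : set (c0 R A)) :
  dense S <-> forall z (e : R[i]), 0 < e -> exists2 f, S f & `|f - z| < e.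
Proof.
split=> [dS z e e0|h O [z Oz] oO].
  have [|f [zf Sf]] := dS (ball z e) _ (ball_open z e).
    by exists z; exact: ballxx.
  exists f => //; move: zf; rewrite -ball_normE /= distrC; exact.
have /nbhs_normP[e /= e0 eO] : \near z, O z by exact: open_nbhs_nbhs.
have [f Sf fz] := h z e e0; exists f; split=> //; apply: eO => /=.
by rewrite distrC.
Qed.

End C0.

(** * Operators that move unit vectors along finite orbits *)

Section IterLinear.
Context {K : pzRingType} {V : lmodType K} (T : {linear V -> V}).

Lemma iter_linear n : linear (iter n T).
Proof. by elim: n => [|n IHn] a f g //; rewrite !iterS IHn linearP. Qed.

HB.instance Definition _ n :=
  GRing.isLinear.Build K V V _ (iter n T) (iter_linear n).

End IterLinear.

Section Shiftlike.
Context {R : realType} {A : countType}.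
Implicit Types (f g h x y : c0 R A) (s : seq A).

(** Abstracts a weighted backward shift on a rooted tree: a unit vector is sent to
a multiple of the unit vector of the parent, and dies once its branch has been
climbed up to the root. *)
Record shiftlike (T : c0 R A -> c0 R A) (M : R[i]) : Prop := Shiftlike {
  shiftlike_ge1 : 1 <= M;
  shiftlike_le : forall f, `|T f| <= M * `|f|;
  shiftlike_delta : forall u, exists c v, T (c0_delta u) = c *: c0_delta v;
  shiftlike_nil : forall u, exists n, iter n T (c0_delta u) = 0
}.

Context (T : {linear c0 R A -> c0 R A}) (M : R[i]).
Context (slT : shiftlike T M).

Let M1 : 1 <= M. Proof. by case: slT. Qed.
Let M0 : 0 <= M. Proof. exact: le_trans ler01 M1. Qed.

Lemma iter_le n f : `|iter n T f| <= M ^+ n * `|f|.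
Proof.
elim: n => [|n IHn]; first by rewrite expr0 mul1r.
rewrite iterS exprS -mulrA (le_trans (shiftlike_le slT _))//.
by rewrite ler_wpM2l.
Qed.

Lemma iter_delta n : exists (c : A -> R[i]) (p : A -> A),
  forall u, iter n T (c0_delta u) = c u *: c0_delta (p u).
Proof.
have /choice[cp h] : forall u, exists cp : R[i] * A,
    iter n T (c0_delta u) = cp.1 *: c0_delta cp.2.
  move=> u; elim: n => [|n [[c v] /= IHn]]; first by exists (1, u); rewrite scale1r.
  have [c' [v' h]] := shiftlike_delta slT v.
  by exists (c * c', v'); rewrite IHn linearZ/= h scalerA.
by exists (fst \o cp), (snd \o cp).
Qed.

Lemma iter_restr n s (F : A -> R[i]) :
  iter n T (c0_restr s F) = \sum_(u <- undup s) F u *: iter n T (c0_delta u).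
Proof. by rewrite linear_sum; apply: eq_bigr => u _; rewrite linearZ. Qed.

Lemma iter_delta_nil s :
  exists N, forall n u, (N <= n)%N -> u \in s -> iter n T (c0_delta u) = 0.
Proof.
elim: s => [|a s [N IHs]]; first by exists 0%N.
have [n an] := shiftlike_nil slT a.
exists (maxn N n) => m u; rewrite geq_max inE => /andP[Nm nm] /orP[/eqP ->|us].
  by rewrite -(subnK nm) iterD an linear0.
exact: IHs.
Qed.

(** The orbit of [x] passes within 1 of the multiple [C] of the indicator of
[a :: s].  Taking [C] beyond [M ^+ N * `|x|] rules out the first [N] iterates, and
taking it beyond [L * `|x|] forces the sums to be at least [L], because a
truncation of [x] has entries of size at most [`|x|].  The vertex [a] is there to
exclude small [n] even when [s] is empty. *)
Lemma hypercyclic_growth x : hypercyclic_vectors T x ->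
  forall (a : A) s N (L : R[i]), 0 <= L ->
  exists n t, [/\ (N <= n)%N, uniq t &
    forall v, v \in s -> L <= \sum_(u <- t) `|iter n T (c0_delta u) v|].
Proof.
move=> /c0_denseP hx a s N L L0.
pose X : R[i] := `|x| + 1; have X0 : 0 < X by rewrite ltr_wpDl.
pose C : R[i] := 2%:R + (L + M ^+ N) * X.
have LM0 : 0 <= L + M ^+ N by rewrite addr_ge0// exprn_ge0.
have C0 : 0 <= C by rewrite addr_ge0// mulr_ge0// ltW.
pose y := c0_restr (a :: s) (fun=> C).
have [_ [n _ <-] xy] := hx y 1 ltr01.
have big v : v \in a :: s -> C - 1 <= `|iter n T x v|.
  move=> vs; rewrite lerBlDr -[leLHS]ger0_norm// -{1}[C](subKr (iter n T x v)).
  apply: le_trans (ler_normB _ _) _; rewrite lerD2l.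
  apply: le_trans (ltW xy); have := normc_le_c0 (iter n T x - y) v.
  by rewrite c0_subE c0_restrE vs.
have [nN|Nn] := ltnP n N.
  have /le_trans/(_ (le_trans (normc_le_c0 _ _) (iter_le _ _))) :=
    big a (mem_head _ _).
  suff /lt_le_trans h : M ^+ n * `|x| < C - 1 by move=> /h; rewrite ltxx.
  have -> : C - 1 = (L + M ^+ N) * X + 1 by rewrite /C; ring.
  rewrite ltr_pwDr// ler_pM ?exprn_ge0//; last by rewrite lerDl.
  by rewrite -[leLHS]add0r lerD// ler_weXn2l// ltnW.
have Mn0 : 0 < M ^+ n by rewrite exprn_gt0// (lt_le_trans ltr01).
have e0 : 0 < (M ^+ n)^-1 by rewrite invr_gt0.
have [t xt] := c0_restr_approx x e0.
exists n, (undup t); split=> // [|v vs]; first exact: undup_uniq.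
have h1 : C - 2%:R <= `|iter n T (c0_restr t x) v|.
  have := big v; rewrite inE vs orbT => /(_ isT) h.
  have -> : C - 2%:R = C - 1 - 1 by ring.
  rewrite lerBlDr (le_trans h)// -lerBlDl (le_trans (lerB_dist _ _))//.
  rewrite -c0_subE -linearB (le_trans (normc_le_c0 _ _))//.
  by rewrite (le_trans (iter_le _ _))// -ler_pdivlMl// mulr1.
have h2 : `|iter n T (c0_restr t x) v| <=
    X * \sum_(u <- undup t) `|iter n T (c0_delta u) v|.
  rewrite iter_restr c0_sumZE (le_trans (ler_norm_sum _ _ _))// mulr_sumr.
  apply: ler_sum => u _; rewrite normrM ler_wpM2r//.
  by rewrite (le_trans (normc_le_c0 _ _))// lerDl.
rewrite -(ler_pM2l X0) (le_trans _ h2)// (le_trans _ h1)//.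
have -> : C - 2%:R = (L + M ^+ N) * X by rewrite /C; ring.
by rewrite mulrC ler_pM2r// lerDl exprn_ge0.
Qed.


(** The value [k u] prescribed for [h u ^+ w.+1] has the phase that makes
[k u * c u] a nonnegative multiple of [y (p u)]; dividing by [Lam] makes these
contributions add up to [y (p u)].  The growth lemma makes [Lam] so large that the
roots are bounded by [e]. *)
Lemma exists_block x : hypercyclic_vectors T x ->
  forall (a : A) (Z F : seq A) y w (d : R[i]), 0 < d ->
    (forall v, v \notin F -> y v = 0) ->
  exists n h s,
  [/\ forall u, u \in Z -> iter n T (c0_delta u) = 0 /\ h u = 0,
      forall u, u \notin s -> h u = 0,
      `|h| <= d,
      iter n T (c0_pow h w) = y &
      forall w', (w < w')%N -> `|iter n T (c0_pow h w')| <= d].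
Proof.
move=> hx a Z F y w d d0 Fy.
pose Y : R[i] := `|y| + 1; have Y0 : 0 < Y by rewrite ltr_wpDl.
(* This [e] lies below [d], below 1 and below [d / Y]. *)
pose e : R[i] := d / ((d + 1) * Y).
have d10 : 0 < d + 1 by rewrite ltr_wpDl// ltW.
have e0 : 0 < e by rewrite divr_gt0// mulr_gt0.
have Y1 : 1 <= Y by rewrite lerDr.
have dY1 : 1 <= (d + 1) * Y by rewrite mulr_ege1// lerDr ltW.
have ed : e <= d by rewrite ler_pdivrMr ?mulr_gt0// ler_peMr// ltW.
have e1 : e <= 1.
  rewrite ler_pdivrMr ?mulr_gt0// mul1r.
  apply: le_trans (_ : d + 1 <= _); first by rewrite lerDl.
  by rewrite ler_peMr// ltW.
have Ye : Y * e <= d.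
  rewrite mulrCA ler_piMr ?(ltW d0)// invfM mulrCA divff ?gt_eqF// mulr1.
  by rewrite invf_le1// lerDr ltW.
have [N NZ] := iter_delta_nil Z.
pose L : R[i] := Y / e ^+ w.+1.
have L0 : 0 < L by rewrite divr_gt0// exprn_gt0.
have [n [s [Nn us hs]]] := hypercyclic_growth hx a F N (ltW L0).
have [c [p cp]] := iter_delta n.
pose Lam v : R[i] := \sum_(u <- s | v == p u) `|c u|.
have LamL v : v \in F -> L <= Lam v.
  move=> /hs /le_trans; apply; rewrite /Lam [leRHS]big_mkcond/= le_eqVlt; apply/orP.
  left; apply/eqP.
  apply: eq_bigr => u _; rewrite cp c0_scaleE c0_deltaE.
  by case: eqP; rewrite ?mulr1// mulr0 normr0.
have Lam0 v : 0 <= Lam v by rewrite sumr_ge0.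
(* If [c u = 0], then [k u = 0], as division by zero gives zero. *)
pose k u : R[i] := y (p u) * (`|c u| / c u) / Lam (p u).
pose h := c0_restr s (fun u => w.+1.-root (k u)).
have hE u : u \in s -> h u ^+ w.+1 = k u.
  by move=> su; rewrite /h c0_restrE su rootCK.
have hN u : u \notin s -> h u = 0 by rewrite /h c0_restrE => /negPf ->.
have kc u : k u * c u = y (p u) * `|c u| / Lam (p u).
  rewrite /k; have [->|c0] := eqVneq (c u) 0; first by rewrite normr0 !(mul0r,mulr0).
  by rewrite mulrAC -[in LHS](mulrA (y _)) divfK.
have hle u : `|h u| <= e.
  have [su|/hN ->] := boolP (u \in s); last by rewrite normr0 ltW.
  rewrite -(@ler_pXn2r _ w.+1) ?nnegrE ?(ltW e0)// -normrX hE//.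
  have [yF|/Fy y0] := boolP (p u \in F); last first.
    by rewrite /k y0 !mul0r normr0 exprn_ge0// ltW.
  rewrite /k !normrM !normfV (ger0_norm (Lam0 _)) normr_id.
  have Lp : 0 < Lam (p u) := lt_le_trans L0 (LamL _ yF).
  rewrite ler_pdivrMr//; apply: le_trans (_ : Y <= _); last first.
    by rewrite mulrC -ler_pdivrMr ?exprn_gt0// LamL.
  apply: le_trans (_ : `|y (p u)| <= _).
    rewrite ler_piMr//; have [->|c0] := eqVneq (c u) 0; first by rewrite normr0 mul0r.
    by rewrite divff ?normr_eq0.
  by rewrite (le_trans (normc_le_c0 _ _))// lerDl.
have ThE m v : iter n T (c0_pow h m) v = \sum_(u <- s | v == p u) h u ^+ m.+1 * c u.
  rewrite -(@c0_restr_id _ _ s (c0_pow h m)) => [|u /hN hu]; last first.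
    by rewrite c0_powE hu expr0n.
  rewrite iter_restr c0_sumZE undup_id// [RHS]big_mkcond.
  apply: eq_bigr => u _; rewrite c0_powE cp c0_scaleE c0_deltaE.
  by case: eqP; rewrite ?mulr1 ?mulr0.
have sumL v : \sum_(u <- s | v == p u) y v * `|c u| / Lam v = y v.
  have [vF|/Fy ->] := boolP (v \in F); last first.
    by rewrite big1// => u _; rewrite !mul0r.
  rewrite -mulr_suml -mulr_sumr -/(Lam v) mulfK// gt_eqF//.
  exact: lt_le_trans (LamL _ vF).
exists n, h, s; split=> // [u uZ|||m wm].
- split; first exact: NZ.
  have := NZ n u Nn uZ; rewrite cp => /eqP; rewrite scaler_eq0.
  rewrite (negPf (c0_nontrivial _)) orbF => /eqP cu.
  rewrite /h c0_restrE; case: ifP => // _.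
  by rewrite /k cu normr0 mul0r mulr0 mul0r rootC0.
- by apply: c0_norm_le => [|u]; [exact: ltW | exact: le_trans ed].
- apply: c0_eq => v; rewrite ThE -[RHS]sumL big_seq_cond [RHS]big_seq_cond.
  by apply: eq_bigr => u /andP[su /eqP ->]; rewrite hE// kc.
- apply: c0_norm_le => [|v]; first exact: ltW.
  rewrite ThE (le_trans (ler_norm_sum _ _ _))//.
  apply: le_trans Ye.
  apply: le_trans (_ : `|y v| * e <= _); last first.
    by rewrite ler_pM2r// (le_trans (normc_le_c0 _ _))// lerDl.
  have <- : \sum_(u <- s | v == p u) `|y v| * `|c u| / Lam v = `|y v|.
    rewrite -[RHS](congr1 Num.norm (sumL v)).
    have [vF|/Fy ->] := boolP (v \in F); last first.
      by rewrite !big1// ?normr0// => i _; rewrite !mul0r.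
    rewrite -!mulr_suml -!mulr_sumr -/(Lam v) !normrM normfV.
    by rewrite (ger0_norm (Lam0 v)).
  rewrite mulr_suml big_seq_cond [leRHS]big_seq_cond.
  apply: ler_sum => u /andP[su /eqP vu].
  rewrite -(subnKC wm) -addnS exprD mulrAC hE// kc -vu normrM ler_pM//.
    by rewrite !normrM normfV normr_id (ger0_norm (Lam0 v)).
  rewrite normrX exprS -[leRHS]mulr1 ler_pM ?exprn_ge0//.
  by rewrite exprn_ile1// (le_trans (hle u)).
Qed.
End Shiftlike.

(** * A countable dense set and a list of requirements *)

Section Approx.
Context {R : realType}.

Lemma small_inv (e : R[i]) : 0 < e -> exists N, forall k,
  (N <= k)%N -> k.+1%:R^-1 < e.
Proof.
move=> e0; have er := RRe_real (gtr0_real e0).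
have e0' : 0 < complex.Re e by rewrite -ltcR er.
exists (Num.truncn (complex.Re e)^-1) => k Nk.
rewrite invf_plt ?posrE ?ltr0n// -er -fmorphV -(rmorph_nat (@real_complex R)) ltcR.
by apply: lt_le_trans (truncnS_gt _) _; rewrite ler_nat ltnS.
Qed.

Lemma complex_rat_approx (z e : R[i]) : 0 < e ->
  exists q : rat * rat, `|Complex (ratr q.1) (ratr q.2) - z| <= e.
Proof.
case: z => a b e0; have er := RRe_real (gtr0_real e0).
have e0' : 0 < complex.Re e by rewrite -ltcR er.
set r := complex.Re e in er e0'.
have h (x : R) : x - r / 2 < x + r / 2.
  by rewrite ltrD2l (lt_trans (y := 0)) ?oppr_lt0 ?divr_gt0.
have [p] := rat_in_itvoo (h a); rewrite in_itv/= => pa.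
have [q] := rat_in_itvoo (h b); rewrite in_itv/= => qb.
exists (p, q); rewrite normc_def/= -er lecR -(gtr0_norm e0') -sqrtr_sqr.
apply: ler_wsqrtr; move: pa qb => /andP[pa1 pa2] /andP[qb1 qb2].
rewrite -/r.
set u := ratr p - a; set v := ratr q - b.
have [u1 u2] : - (r / 2) <= u /\ u <= r / 2 by rewrite /u; lra.
have [v1 v2] : - (r / 2) <= v /\ v <= r / 2 by rewrite /v; lra.
by nra.
Qed.
End Approx.

Section FiniteVectors.
Context {R : realType} {A : countType}.

Definition finvec (s : seq (A * (rat * rat))) : c0 R A :=
  \sum_(a <- s) Complex (ratr a.2.1) (ratr a.2.2) *: c0_delta a.1.

Definition vertices (s : seq (A * (rat * rat))) := [seq a.1 | a <- s].

Lemma finvec_notin s v : v \notin vertices s -> finvec s v = 0.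
Proof.
move=> vs; rewrite c0_sumZE big1_seq// => a /andP[_ sa].
rewrite c0_deltaE; case: eqP => [va|_]; last by rewrite mulr0.
by rewrite va map_f in vs.
Qed.

Lemma finvec_dense (z : c0 R A) e : 0 < e -> exists s, `|finvec s - z| < e.
Proof.
move=> e0; have e3 : 0 < e / 3%:R by rewrite divr_gt0.
have [t zt] := c0_restr_approx z e3.
have /choice[q hq] := fun v => complex_rat_approx (z v) e3.
exists [seq (v, q v) | v <- undup t].
have -> : finvec [seq (v, q v) | v <- undup t] =
    c0_restr t (fun v => Complex (ratr (q v).1) (ratr (q v).2)).
  by rewrite /finvec big_map.
set f := c0_restr t _.
have h : `|f - c0_restr t z| <= e / 3%:R.
  apply: c0_norm_le => [|v]; first exact: ltW.
  rewrite c0_subE !c0_restrE; case: ifP => _; first exact: hq.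
  by rewrite subrr normr0 ltW.
rewrite -(subrKA (c0_restr t z)) (le_lt_trans (ler_normD _ _))//.
rewrite [X in _ + X]distrC (le_lt_trans (lerD h zt))// -mulrDl.
by rewrite ltr_pdivrMr// mulr_natr mulrSr mulr2n ltrDl.
Qed.

End FiniteVectors.

Section Requirements.
Context (A : countType).

(** The triple [((K, w), s)] asks for a block on which the generators are the
powers of exponents [K.+1 ^ i] of a single family, and whose power of exponent
[w.+1] is sent to [finvec s]. *)
Definition requirement : Type := (nat * nat * seq (A * (rat * rat)))%type.

Definition req (k : nat) : requirement :=
  odflt (0%N, 0%N, [::]) (choice.unpickle (nth 0%N (CodeSeq.decode k) 1)).

(** The code of a sequence exceeds each of its entries, so storing [N] as an entry
that [req] ignores makes the same requirement come back after [N]. *)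
Lemma req_often (r : requirement) N : exists2 k, (N <= k)%N & req k = r.
Proof.
exists (CodeSeq.code [:: N; choice.pickle r]).
  by have /andP[/ltnW] := CodeSeq.ltn_code [:: N; choice.pickle r].
by rewrite /req CodeSeq.codeK/= choice.pickleK.
Qed.

End Requirements.

(** * Kronecker substitution *)

Section Kronecker.
Context {d : nat} (s : 'I_d -> nat) (s_inj : injective s).
Implicit Types m : multinom d.

(** The exponent of the monomial [m] after the substitution of ['X ^+ (K ^ s i)]
for the [i]-th variable. *)
Definition kron K m := (\sum_(i < d) m i * K ^ s i)%N.

Lemma kron_gt0 K m : (0 < K)%N -> m != mnm0 -> (0 < kron K m)%N.
Proof.
move=> K0; rewrite lt0n; apply: contraNneq => /eqP.
rewrite sum_nat_eq0 => /forallP/= h; apply/eqP/mnmP => i.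
by have := h i; rewrite mnm0E muln_eq0 expn_eq0 (gtn_eqF K0) orbF => /eqP.
Qed.

(** The [m i] are the digits of [kron K m] in base [K], in places [s i] that are
distinct; they are recovered from the lowest place upwards, modulo [K]. *)
Lemma kron_inj K m m' : (forall i, m i < K)%N -> (forall i, m' i < K)%N ->
  kron K m = kron K m' -> m = m'.
Proof.
move=> mK mK' kmm; apply/mnmP => i; move: {2}(s i) (erefl (s i)) => n.
elim/ltn_ind: n i => n IHn i si.
have K0 : (0 < K)%N by apply: leq_ltn_trans (mK i).
have split (p : multinom d) : kron K p = (\sum_(j | s j < n) p j * K ^ s j +
    K ^ n * (p i + K * \sum_(j | ~~ (s j < n) && (j != i)) p j * K ^ (s j - n.+1)))%N.
  rewrite /kron (bigID (fun j => s j < n)%N)/= [X in (_ + X)%N](bigD1 i) ?si ?ltnn//=.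
  congr (_ + _)%N; rewrite mulnDr mulnA -expnSr big_distrr/= [(K ^ n * p i)%N]mulnC.
  congr (_ + _)%N; apply: eq_bigr => j /andP[nj ji].
  rewrite mulnCA -expnD subnKC// ltn_neqAle leqNgt nj andbT -si.
  by apply: contra_neq ji => /s_inj.
move: kmm; rewrite !split.
have -> : (\sum_(j | s j < n) m j * K ^ s j = \sum_(j | s j < n) m' j * K ^ s j)%N.
  by apply: eq_bigr => j jn; rewrite (IHn _ jn j erefl).
move=> /addnI/eqP; rewrite eqn_pmul2l ?expn_gt0 ?K0// => /eqP.
move=> /(congr1 (modn^~ K)); rewrite ![(K * _)%N]mulnC.
rewrite ![(_ + _ * K)%N]addnC !modnMDl.
by rewrite !modn_small.
Qed.

Lemma kron_inj_on (r : seq (multinom d)) : exists K,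
  {in r &, injective (kron K.+1)}.
Proof.
exists (\sum_(m <- r) \sum_(i < d) m i)%N => m m' mr mr'.
have h p : p \in r -> forall i, (p i < (\sum_(m <- r) \sum_(i < d) m i).+1)%N.
  move=> pr i; rewrite ltnS (big_rem p)//= (bigD1 i)//= -addnA.
  exact: leq_addr.
by apply: kron_inj; exact: h.
Qed.

End Kronecker.

Lemma seq_argmin (T : eqType) (r : seq T) (F : T -> nat) : r != [::] ->
  exists2 x, x \in r & forall y, y \in r -> (F x <= F y)%N.
Proof.
case: r => // a r _; elim: r a => [|b r IHr] a.
  by exists a; rewrite ?mem_head// => y; rewrite inE => /eqP ->.
have [x xr xmin] := IHr b; have [ax|xa] := leqP (F a) (F x).
  exists a; rewrite ?mem_head// => y; rewrite inE => /orP[/eqP ->//|/xmin].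
  exact: leq_trans.
exists x; first by rewrite inE xr orbT.
by move=> y; rewrite inE => /orP[/eqP ->|/xmin//]; exact: ltnW.
Qed.

Lemma monomial_le (K : numDomainType) d (m : multinom d) (g : 'I_d -> K) t :
  m != mnm0 -> t <= 1 -> (forall i, `|g i| <= t) ->
  `|\prod_i g i ^+ m i| <= t.
Proof.
move=> m0 t1 gt.
have [i mi] : exists i, m i != 0%N.
  apply/existsP; apply: contraNT m0 => /existsPn/= h.
  by apply/eqP/mnmP => i; rewrite mnm0E; apply/eqP; rewrite -[_ == _]negbK.
have t0 : 0 <= t by apply: le_trans (gt i).
rewrite normr_prod (bigD1 i)//= -[leRHS]mulr1 ler_pM ?prodr_ge0//.
  rewrite normrX -(prednK (n := m i)) ?lt0n// exprS -[leRHS]mulr1.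
  by rewrite ler_pM ?exprn_ge0// exprn_ile1// (le_trans (gt i)).
apply: prodr_ile1 => j _; rewrite normr_ge0 normrX exprn_ile1//.
exact: le_trans (gt j) t1.
Qed.

(** * The sequence of blocks *)

Section BlockSequence.
Context (R : realType) (A : countType).

Definition target k : c0 R A := finvec (req A k).2.
Definition base_exp k := (req A k).1.1.+1.
Definition low_exp k := (req A k).1.2.

(** [Z k] is a finite set of vertices already in use at stage [k], and [eta k] the
size allowed for the block [h k].  The field [block_eta_next] makes all later
blocks invisible to the [n k]-th iterate of [T]. *)
Record block_sequence (T : c0 R A -> c0 R A) (M : R[i]) (n : nat -> nat)
    (h : nat -> c0 R A) (Z : nat -> seq A) (eta : nat -> R[i]) : Prop := {
  block_target k v : v \notin Z k -> target k v = 0;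
  block_mono k v : v \in Z k -> v \in Z k.+1;
  block_supp k v : h k v != 0 -> v \in Z k.+1;
  block_new k v : v \in Z k -> h k v = 0;
  block_kill k v : v \in Z k -> iter (n k) T (c0_delta v) = 0;
  block_hit k : iter (n k) T (c0_pow (h k) (low_exp k)) = target k;
  block_higher k w : (low_exp k < w)%N ->
    `|iter (n k) T (c0_pow (h k) w)| <= eta k;
  block_small k : `|h k| <= eta k;
  block_eta_dec k : eta k.+1 <= eta k;
  block_eta_le k : eta k <= k.+1%:R^-1;
  block_eta_next k : M ^+ n k * eta k.+1 <= k.+1%:R^-1
}.

Lemma block_sequence_exists (T : {linear c0 R A -> c0 R A}) M x (a : A) :
  shiftlike T M -> hypercyclic_vectors T x ->
  exists n h Z eta, block_sequence T M n h Z eta.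
Proof.
move=> slT hx.
have M1 := shiftlike_ge1 slT; have M0 : 0 < M := lt_le_trans ltr01 M1.
have /choice[F hF] : forall p : nat * (seq A * R[i]),
  exists b : nat * c0 R A * seq A, 0 < p.2.2 ->
  [/\ forall u, u \in p.2.1 -> iter b.1.1 T (c0_delta u) = 0 /\ b.1.2 u = 0,
      forall u, u \notin b.2 -> b.1.2 u = 0,
      `|b.1.2| <= p.2.2,
      iter b.1.1 T (c0_pow b.1.2 (low_exp p.1)) = target p.1 &
      forall w, (low_exp p.1 < w)%N -> `|iter b.1.1 T (c0_pow b.1.2 w)| <= p.2.2].
  move=> [k [Z d]] /=; have [d0|nd0] := pselect (0 < d); last first.
    by exists (0%N, 0, [::]).
  have [n [h [s hb]]] := exists_block slT hx a Z (low_exp k) d0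
    (fun v => @finvec_notin R A (req A k).2 v).
  by exists (n, h, s).
pose supp k := vertices (req A k).2.
(* Dividing by [k'.+2] and by the bound [M ^+ n] of the iterate chosen at stage
   [k'] yields [block_eta_le] and [block_eta_next] at once. *)
pose st := fix st k : seq A * R[i] := if k is k'.+1 then
  ((st k').1 ++ (F (k', st k')).2 ++ supp k'.+1,
   (st k').2 / (k'.+2%:R * M ^+ (F (k', st k')).1.1)) else (supp 0%N, 1).
pose b k := F (k, st k).
have st0 k : 0 < (st k).2.
  by elim: k => //= k IHk; rewrite divr_gt0// mulr_gt0// exprn_gt0.
have Mge k : 1 <= M ^+ k by rewrite exprn_ege1.
have kge k : 1 <= k.+1%:R :> R[i] by rewrite ler1n.
have dec k : (st k.+1).2 <= (st k).2.
  rewrite /= ler_pdivrMr ?mulr_gt0 ?exprn_gt0// ler_peMr ?(ltW (st0 k))//.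
  by rewrite mulr_ege1.
have st1 k : (st k).2 <= 1 by elim: k => [|k IHk]//; exact: le_trans (dec k) IHk.
have next k : M ^+ (b k).1.1 * (st k.+1).2 <= k.+2%:R^-1.
  rewrite /= invfM mulrCA (mulrC _^-1) mulVKf ?gt_eqF ?exprn_gt0//.
  by rewrite ler_piMl ?invr_ge0.
exists (fun k => (b k).1.1), (fun k => (b k).1.2).
exists (fun k => (st k).1), (fun k => (st k).2).
split=> k; have [h1 h2 h3 h4 h5] := hF (k, st k) (st0 k) => //=.
- move=> v vZ; apply: finvec_notin; apply: contra vZ.
  by case: k {h1 h2 h3 h4 h5} => //= k vk; rewrite !mem_cat vk !orbT.
- by move=> v vZ; rewrite mem_cat vZ.
- move=> v; apply: contraNT; rewrite !mem_cat !negb_or => /and3P[_ vs _].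
  by apply/eqP; exact: h2.
- by move=> v /h1[].
- by move=> v /h1[].
- exact: dec.
- case: k {h1 h2 h3 h4 h5} => [|k]; first by rewrite /= invr1.
  apply: le_trans (next k); rewrite ler_peMl// ltW//; exact: st0.
- apply: le_trans (next k) _.
  by rewrite lef_pV2 ?posrE ?ltr0n// ler_nat.
Qed.

End BlockSequence.

(** * The generators and their polynomials *)

Section Generators.
Context {R : realType} {A : countType} (T : {linear c0 R A -> c0 R A}).
Context (M : R[i]) (n : nat -> nat) (h : nat -> c0 R A) (Z : nat -> seq A).
Context (eta : nat -> R[i]).
Context (slT : shiftlike T M).
Context (bs : block_sequence T M n h Z eta).

Lemma block_le_mono i j v : (i <= j)%N -> v \in Z i -> v \in Z j.
Proof.
move=> /subnKC <-; elim: (j - i)%N => [|k IHk]; rewrite ?addn0// addnS => vi.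
exact: (block_mono bs (IHk vi)).
Qed.

Lemma eta_ge0 k : 0 <= eta k.
Proof. exact: le_trans (block_small bs k). Qed.

Lemma eta_anti i j : (i <= j)%N -> eta j <= eta i.
Proof.
move=> /subnKC <-; elim: (j - i)%N => [|k IHk]; rewrite ?addn0// addnS.
exact: le_trans (block_eta_dec bs _) IHk.
Qed.

Lemma eta_le1 k : eta k <= 1.
Proof.
by apply: le_trans (block_eta_le bs k) _; rewrite invf_le1// ler1n.
Qed.

(** The supports of the blocks are disjoint, so this is the only block containing
[v], if there is one; otherwise it is 0 and [h 0 v = 0]. *)
Definition block_index v : nat := xget 0%N [set k | h k v != 0].

Lemma block_indexE k v : h k v != 0 -> block_index v = k.
Proof.
have lt_false i j : h i v != 0 -> h j v != 0 -> ~ (i < j)%N.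
  move=> hi hj ij; move: hj; rewrite (block_new bs) ?eqxx//.
  exact: block_le_mono ij (block_supp bs hi).
move=> hk; rewrite /block_index; case: xgetP => [j _ /= hj|/(_ k)]; last by [].
by case: (ltngtP j k) => // ?; exfalso; [exact: lt_false hj hk _|exact: lt_false hk hj _].
Qed.

(** Generator [i] uses the blocks from the [i]-th on, which are all of size at most
[eta i], so that it stays close to its target. *)
Definition tail_fun i v : R[i] :=
  if (i <= block_index v)%N
  then h (block_index v) v ^+ (base_exp A (block_index v) ^ i) else 0.

Lemma base_exp_gt0 k i : (0 < base_exp A k ^ i)%N.
Proof. by rewrite expn_gt0. Qed.

Lemma tail_fun_neq0 i v : tail_fun i v != 0 ->
  (i <= block_index v)%N /\ h (block_index v) v != 0.
Proof.
rewrite /tail_fun; case: leqP => [ik|_]; last by rewrite eqxx.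
by rewrite expf_eq0 base_exp_gt0.
Qed.

Lemma tail_fun_le i v : `|tail_fun i v| <= eta (block_index v).
Proof.
rewrite /tail_fun; case: ifP => _; last by rewrite normr0 eta_ge0.
have hle : `|h (block_index v) v| <= eta (block_index v).
  exact: le_trans (normc_le_c0 _ _) (block_small bs _).
rewrite normrX -(prednK (base_exp_gt0 _ i)) exprS -[leRHS]mulr1.
rewrite ler_pM ?exprn_ge0// exprn_ile1//.
exact: le_trans hle (eta_le1 _).
Qed.

Lemma tail_subproof i : tail_fun i \in @c0_pred R A.
Proof.
rewrite inE => e e0; have [N Ne] := small_inv e0.
exists [set` Z N]; first exact: finite_seq.
move=> v /= /negP vN; have [->|/tail_fun_neq0[_ hv]] := eqVneq (tail_fun i v) 0.
  by rewrite normr0.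
apply: le_lt_trans (tail_fun_le i v) _.
apply: le_lt_trans (block_eta_le bs _) _; apply: Ne.
rewrite leqNgt; apply: contra vN => bN.
exact: block_le_mono bN (block_supp bs hv).
Qed.

Definition gen i : c0 R A := target R A i + C0 (tail_subproof i).

Lemma genE i v : gen i v = target R A i v + tail_fun i v. Proof. by []. Qed.

Lemma gen_target i : `|gen i - target R A i| <= i.+1%:R^-1.
Proof.
rewrite addrC addKr; apply: le_trans (block_eta_le bs i).
apply: c0_norm_le => [|v]; first exact: eta_ge0.
have [vi|vi] := leqP i (block_index v).
  by apply: le_trans (tail_fun_le i v) _; exact: eta_anti.
by rewrite [C0 _ _]/(tail_fun i v) /tail_fun leqNgt vi normr0 eta_ge0.
Qed.

(** The targets of the generators up to the [k]-th live on [Z k], so outside [Z k]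
and outside the block [k] only later blocks are left. *)
Lemma gen_later i k v : (i <= k)%N -> v \notin Z k -> h k v = 0 ->
  `|gen i v| <= eta k.+1.
Proof.
move=> ik vk hk; rewrite genE (block_target bs) ?add0r; last first.
  by apply: contra vk; exact: block_le_mono.
have [->|/tail_fun_neq0[_ hv]] := eqVneq (tail_fun i v) 0.
  by rewrite normr0 eta_ge0.
apply: le_trans (tail_fun_le i v) _; apply: eta_anti.
case: (ltngtP k (block_index v)) => // [lt|e].
  by move: vk; rewrite (block_le_mono lt (block_supp bs hv)).
by move: hv; rewrite -e hk eqxx.
Qed.

Lemma gen_block i k v : (i <= k)%N -> v \notin Z k -> h k v != 0 ->
  gen i v = h k v ^+ (base_exp A k ^ i).
Proof.
move=> ik vk hk; rewrite genE (block_target bs) ?add0r; last first.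
  by apply: contra vk; exact: block_le_mono.
by rewrite /tail_fun (block_indexE hk) ik.
Qed.

(** Split [f] into its restriction to [Z k], which [T] kills by time [n k], the
polynomial [f2] in [h k], and the rest [f3], which only sees later blocks.  In
[f2] the term of lowest exponent is sent to the target, the other ones to small
vectors. *)
Lemma orbit_target d (P : mpoly d R[i]) (s : 'I_d -> nat) (f : c0 R A) k m0 :
  mcoeff mnm0 P = 0 -> (forall v, f v = meval (fun i => gen (s i) v) P) ->
  (forall i, s i <= k)%N -> m0 \in msupp P ->
  kron s (base_exp A k) m0 = (low_exp A k).+1 ->
  (forall m, m \in msupp P -> m != m0 ->
     (kron s (base_exp A k) m0 < kron s (base_exp A k) m)%N) ->
  `|iter (n k) T f - mcoeff m0 P *: target R A k| <=
    2%:R * (\sum_(m <- msupp P) `|mcoeff m P|) * k.+1%:R^-1.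
Proof.
move=> P0 fE sk m0P wm0 wmin.
set w := kron s (base_exp A k) in wm0 wmin; set C := \sum_(m <- _) _.
have C_ge0 : 0 <= C by rewrite sumr_ge0.
have m_neq0 m : m \in msupp P -> m != mnm0.
  by apply: contraTneq => ->; rewrite -mcoeff_eq0 P0.
have w_gt0 m : m \in msupp P -> (0 < w m)%N.
  by move=> mP; apply: kron_gt0 => //; exact: m_neq0.
pose f2 := \sum_(m <- msupp P) mcoeff m P *: c0_pow (h k) (w m).-1.
have f2E v : f2 v = \sum_(m <- msupp P) mcoeff m P * h k v ^+ w m.
  rewrite c0_sumZE; apply: eq_big_seq => m mP.
  by rewrite c0_powE prednK// w_gt0.
pose f3 := f - c0_restr (Z k) f - f2.
have f3_le : `|f3| <= C * eta k.+1.
  apply: c0_norm_le => [|v]; first by rewrite mulr_ge0// eta_ge0.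
  rewrite !c0_subE c0_restrE f2E; case: ifPn => vZ.
    rewrite subrr (block_new bs vZ) big1_seq ?subr0 ?normr0; last first.
      by move=> m /andP[_ mP]; rewrite expr0n (gtn_eqF (w_gt0 m mP)) mulr0.
    by rewrite mulr_ge0// eta_ge0.
  rewrite subr0 fE mevalE; have [hk|hk] := eqVneq (h k v) 0.
    rewrite hk [X in _ - X]big1_seq ?subr0; last first.
      by move=> m /andP[_ mP]; rewrite expr0n (gtn_eqF (w_gt0 m mP)) mulr0.
    rewrite (le_trans (ler_norm_sum _ _ _))// mulr_suml.
    rewrite big_seq [leRHS]big_seq; apply: ler_sum => m mP.
    rewrite normrM ler_wpM2l// monomial_le ?m_neq0 ?eta_le1// => i.
    by rewrite gen_later.
  rewrite -sumrB big1 ?normr0 ?mulr_ge0 ?eta_ge0// => m _.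
  rewrite -mulrBr -[X in _ - X](_ : \prod_i gen (s i) v ^+ m i = _).
    by rewrite subrr mulr0.
  rewrite /w /kron -prodrXr; apply: eq_bigr => i _.
  by rewrite (gen_block (sk i))// -exprM mulnC.
have fsplit : f = c0_restr (Z k) f + f2 + f3 by rewrite /f3 -addrA subrKC subrKC.
clearbody f3; rewrite fsplit !linearD/=.
have -> : iter (n k) T (c0_restr (Z k) f) = 0.
  rewrite iter_restr big1_seq// => v /andP[_]; rewrite mem_undup => vZ.
  by rewrite (block_kill bs vZ) scaler0.
rewrite add0r.
have -> : iter (n k) T f2 = mcoeff m0 P *: target R A k +
   \sum_(m <- msupp P | m != m0) mcoeff m P *: iter (n k) T (c0_pow (h k) (w m).-1).
  rewrite linear_sum (bigD1_seq m0) ?msupp_uniq//= linearZ/= wm0/= (block_hit bs).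
  by congr (_ + _); apply: eq_bigr => m _; rewrite linearZ.
rewrite -(addrA (mcoeff _ _ *: _)) [X in `|X|]addrC addKr.
rewrite (le_trans (ler_normD _ _))// -mulrA mulr_natl mulr2n.
apply: lerD.
  rewrite (le_trans (ler_norm_sum _ _ _))// mulr_suml [leRHS](bigID (fun m => m != m0))/=.
  apply: ler_wpDr; first by apply: sumr_ge0 => m _; rewrite mulr_ge0.
  rewrite big_seq_cond [leRHS]big_seq_cond.
  apply: ler_sum => m /andP[mP mm0]; rewrite normrZ ler_wpM2l//.
  apply: le_trans (block_eta_le bs k); apply: (block_higher bs).
  by rewrite -ltnS -wm0 prednK ?w_gt0// wmin.
rewrite (le_trans (iter_le slT _ _))//.
rewrite (le_trans (ler_wpM2l _ f3_le)) ?exprn_ge0 ?(le_trans ler01 (shiftlike_ge1 slT))//.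
by rewrite mulrCA ler_wpM2l// (block_eta_next bs).
Qed.

(** The constant [K] of the substitution and then the lowest exponent [w0.+1] are
fixed by [P]; the target still varies freely among the requirements, and
multiplying it by the nonzero coefficient [c] preserves density. *)
Lemma poly_hypercyclic d (P : mpoly d R[i]) (s : 'I_d -> nat) (f : c0 R A) :
  injective s -> P != 0 -> mcoeff mnm0 P = 0 ->
  (forall v, f v = meval (fun i => gen (s i) v) P) -> hypercyclic_vectors T f.
Proof.
move=> s_inj P_neq0 P0 fE; apply/c0_denseP => z e e0.
have [K K_inj] := kron_inj_on s_inj (msupp P).
have [|m0 m0P m0min] := @seq_argmin _ (msupp P) (kron s K.+1).
  by rewrite msupp_eq0.
set c := mcoeff m0 P.
have c_neq0 : c != 0 by rewrite mcoeff_eq0 m0P.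
have c_gt0 : 0 < `|c| by rewrite normr_gt0.
have e2 : 0 < e / 2%:R by rewrite divr_gt0.
have [t tz] := finvec_dense (c^-1 *: z) (divr_gt0 e2 c_gt0).
set C := \sum_(m <- msupp P) `|mcoeff m P|.
have C1 : 0 < C + 1 by rewrite ltr_wpDl// sumr_ge0.
have [N Ne] : exists N, forall k, (N <= k)%N -> k.+1%:R^-1 < e / 2 / (2 * (C + 1)).
  by apply: small_inv; rewrite divr_gt0// mulr_gt0.
pose w0 := (kron s K.+1 m0).-1.
have w0E : w0.+1 = kron s K.+1 m0.
  rewrite prednK// kron_gt0//; apply: contraTneq m0P => ->.
  by rewrite -mcoeff_eq0 P0.
have [k Nk reqk] := req_often (K, w0, t) (maxn N (\max_(i < d) s i)).
move: Nk; rewrite geq_max => /andP[Nk sk].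
exists (iter (n k) T f); first by exists (n k).
have tk : target R A k = finvec t by rewrite /target reqk.
have wk : base_exp A k = K.+1 by rewrite /base_exp reqk.
have := orbit_target (k := k) P0 fE _ m0P.
rewrite wk /low_exp reqk w0E tk => orb.
rewrite -(subrKA (c *: finvec t)) (le_lt_trans (ler_normD _ _))//.
rewrite [ltRHS]splitr; apply: ler_ltD.
  apply: le_trans (orb _ erefl _) _ => [i|m mP mm0|].
  - by apply: leq_trans sk; exact: leq_bigmax.
  - rewrite ltn_neqAle m0min// andbT; apply: contra_neq mm0 => /K_inj -> //.
  have := ltW (Ne k Nk); rewrite ler_pdivlMr ?mulr_gt0// mulrC.
  apply: le_trans; rewrite ler_wpM2r// ler_wpM2l//.
  by rewrite lerDl.
rewrite -[z in ltLHS](scalerKV c_neq0) -scalerBr normrZ mulrC.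
by rewrite -ltr_pdivlMr ?normr_gt0.
Qed.

End Generators.

(** * The algebra *)

Lemma mcoeff0_var (R : nzRingType) d (i : 'I_d) :
  mcoeff mnm0 (mpolyX R (mnm1 i)) = 0.
Proof.
rewrite mcoeffX; case: eqP => // /mnmP/(_ i).
by rewrite mnm1E mnm0E eqxx.
Qed.

Section Algebra.
Context {R : realType} {A : choiceType}.
Implicit Types (f g : c0 R A) (G : set (c0 R A)).

Lemma subalgebra_smallest G : subalgebra (smallest subalgebra G).
Proof.
split=> [S [[]]|f g fS gS S SG|a f fS S SG|f g fS gS S SG] //.
- by apply: (subalgD SG.1); [exact: fS | exact: gS].
- by apply: (subalgZ SG.1); exact: fS.
- by apply: (subalgM SG.1); [exact: fS | exact: gS].
Qed.

(** Asking for a polynomial in every large number of variables makes sums and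
products immediate: two values always have polynomials in the same variables. *)
Definition poly_values (gen : nat -> c0 R A) : set (c0 R A) :=
  [set f | exists d0, forall d, (d0 <= d)%N -> exists P : mpoly d R[i],
    mcoeff mnm0 P = 0 /\
    forall v, f v = meval (fun i : 'I_d => gen i v) P].

Lemma smallest_poly_values gen :
  smallest subalgebra (range gen) `<=` poly_values gen.
Proof.
apply: smallest_sub => [|_ [i _ <-]].
  split=> [|f g [df hf] [dg hg]|a f [df hf]|f g [df hf] [dg hg]].
  - exists 0%N => d _; exists 0; rewrite mcoeff0; split=> // v.
    by rewrite raddf0.
  - exists (maxn df dg) => d; rewrite geq_max => /andP[/hf[P [P0 fP]] /hg[Q [Q0 gQ]]].
    exists (P + Q); rewrite mcoeffD P0 Q0 addr0; split=> // v.
    by rewrite mevalD -fP -gQ.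
  - exists df => d /hf[P [P0 fP]]; exists (a *: P); rewrite mcoeffZ P0 mulr0.
    by split=> // v; rewrite mevalZ -fP.
  - exists (maxn df dg) => d; rewrite geq_max => /andP[/hf[P [P0 fP]] /hg[Q [Q0 gQ]]].
    exists (P * Q); split=> [|v]; last by rewrite mevalM -fP -gQ.
    by rewrite (mcoeff0_is_multiplicative _ _).1 P0 mul0r.
exists i.+1 => d id; exists (mpolyX _ (mnm1 (Ordinal id))).
by rewrite mcoeff0_var; split=> // v; rewrite mevalXU.
Qed.

End Algebra.

Section MainConstruction.
Context {R : realType} {A : countType} (T : {linear c0 R A -> c0 R A}).
Context (M : R[i]) (a : A).

Lemma hypercyclic_vector_neq0 f : hypercyclic_vectors T f -> f != 0.
Proof.
move=> /c0_denseP h; apply/eqP => f0.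
have d0 : 0 < `|c0_delta a : c0 R A| by rewrite normr_gt0 c0_nontrivial.
have [_ [n _ <-]] := h (c0_delta a) _ d0.
by rewrite f0 linear0 sub0r normrN ltxx.
Qed.

Lemma hypercyclic_free_algebra : shiftlike T M -> hypercyclic T ->
  exists S, [/\ hypercyclic_algebra T S, dense S & countably_generated_free S].
Proof.
move=> slT [x hx].
have [n [h [Z [eta bs]]]] := block_sequence_exists a slT hx.
pose g := gen bs.
have key d (P : mpoly d R[i]) s (f : c0 R A) : injective s -> P != 0 ->
    mcoeff mnm0 P = 0 -> (forall v, f v = meval (fun i => g (s i) v) P) -> f != 0.
  move=> s_inj P0 Pm fE; apply: hypercyclic_vector_neq0.
  exact: (poly_hypercyclic slT s_inj P0 Pm fE).
have g_indep d (P : mpoly d R[i]) s : injective s -> P != 0 ->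
    mcoeff mnm0 P = 0 -> (fun v => meval (fun i => g (s i) v) P) <> (fun=> 0).
  move=> si P0 Pm e; suff : (0 : c0 R A) != 0 by rewrite eqxx.
  by apply: key si P0 Pm _ => v; exact: esym (congr1 (fun F => F v) e).
have g_inj : injective g.
  (* Equal generators would be a zero of the polynomial ['X_0 - 'X_1]. *)
  move=> i j gij; apply/eqP; apply: contrapT => /negP ij.
  pose s (k : 'I_2) := if k == ord0 then i else j.
  pose X (k : 'I_2) : mpoly 2 R[i] := mpolyX _ (mnm1 k).
  apply: (g_indep 2 (X ord0 - X ord_max) s).
  - have ji : (j == i) = false by rewrite eq_sym; exact: negbTE.
    move=> k l; rewrite /s; case: (unliftP ord0 k) => [k' ->|->];
      case: (unliftP ord0 l) => [l' ->|->] //=.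
    + by rewrite !ord1.
    + by move/eqP; rewrite ji.
    + by move/esym/eqP; rewrite ji.
  - apply/eqP => /(congr1 (meval (fun k => (k == ord0)%:R))).
    rewrite mevalB !mevalXU [meval _ 0]raddf0 /= subr0 => /eqP.
    by rewrite oner_eq0.
  - by rewrite mcoeffB !mcoeff0_var subr0.
  - apply/funext => v; rewrite mevalB !mevalXU; apply/eqP; rewrite subr_eq0.
    by apply/eqP; exact: (congr1 (fun f : c0 R A => f v) gij).
pose S := smallest subalgebra (range g).
have S_hyp f : S f -> f != 0 -> hypercyclic_vectors T f.
  move=> /smallest_poly_values[d /(_ _ (leqnn d))[P [Pm fP]]] f0.
  apply: (poly_hypercyclic slT (P := P) (s := val) val_inj _ Pm fP).
  apply: contraNneq f0 => P0; apply/eqP/c0_eq => v.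
  by rewrite fP P0 raddf0.
have gS i : S (g i) by apply: sub_gen_smallest; exists i.
have g_neq0 i : g i != 0.
  apply: (key 1 (mpolyX _ (mnm1 ord0)) (fun=> i)) => [k l _||//|v].
  - by rewrite !ord1.
  - by rewrite -msupp_eq0 msuppX.
  - exact: mcoeff0_var.
  - by rewrite mevalXU.
exists S; split.
- split; first exact: subalgebra_smallest.
    by apply/eqP => S0; have := gS 0%N; rewrite S0 => /eqP; apply/negP.
  by move=> f Sf; have [->|f0] := eqVneq f 0; [right | left; exact: S_hyp].
- apply/c0_denseP => z e e0.
  have e2 : 0 < e / 2%:R by rewrite divr_gt0.
  have [t tz] := finvec_dense z e2; have [N Ne] := small_inv e2.
  have [k Nk rk] := req_often (0%N, 0%N, t) N.
  exists (g k) => //; rewrite -(subrKA (target R A k)) [ltRHS]splitr.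
  rewrite (le_lt_trans (ler_normD _ _))// ltrD//; last by rewrite /target rk.
  exact: le_lt_trans (gen_target bs k) (Ne k Nk).
- exists (range g); split=> //.
    exact: inj_card_eq (in2W g_inj).
  move=> d d0 f f_inj fg P P0 Pm.
  have /choice[s sE] : forall i, exists k, g k = f i.
    by move=> i; have [k _ <-] := fg i; exists k.
  have -> : (fun v => meval (fun i => f i v) P) = (fun v => meval (fun i => g (s i) v) P).
    by apply/funext => v; congr (meval _ P); apply/funext => i; rewrite sE.
  apply: g_indep => // i j sij; apply: f_inj.
  by rewrite -!sE sij.
Qed.
End MainConstruction.

(** * Weighted backward shifts on rooted trees *)

Section Shift.
Context {R : realType} {A : countType} (E : rel A) (lambda : A -> R[i]).
Context (B : c0 R A -> c0 R A).
Context (shift_B : is_weighted_backward_shift E lambda B).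

Lemma shift_value (f : c0 R A) v (l : R[i]^o) :
  partial_sum (fun u : Chi E v => lambda (val u) * f (val u)) @ totally --> l ->
  B f v = l.
Proof.
have FF := @totally_filter (Chi E v : choiceType).
move=> fl; have h := @cvg_unique R[i]^o (@norm_hausdorff _ R[i]^o) _
  (fmap_proper_filter _ FF).
exact: h (@shift_B f v) fl.
Qed.

Lemma shift_linear : linear B.
Proof.
move=> a f g; apply: c0_eq => v; apply: shift_value.
rewrite c0_addE c0_scaleE.
have FF := @totally_filter (Chi E v : choiceType).
have := @cvgD _ R[i]^o _ _ FF _ _ _ _
  (@cvgZl_tmp _ R[i]^o _ _ FF a _ _ (@shift_B f v)) (@shift_B g v).
apply: cvg_trans; apply: near_eq_cvg; apply: nearW => F.
transitivity (a * (\sum_(i : F) lambda (val (val i)) * f (val (val i))) +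
    \sum_(i : F) lambda (val (val i)) * g (val (val i))); first by [].
rewrite /partial_sum.
rewrite mulr_sumr -big_split; apply: eq_bigr => u _.
by rewrite c0_addE c0_scaleE mulrDr mulrCA.
Qed.

Lemma shift_delta u w : B (c0_delta u) w = if E w u then lambda u else 0.
Proof.
apply: shift_value.
have delta0 (u' : Chi E w) : val u' != u -> lambda (val u') * c0_delta u (val u') = 0.
  by move=> u'u; rewrite c0_deltaE (negPf u'u) mulr0.
have FF := @totally_filter (Chi E w : choiceType).
apply: (@cvg_near_cst _ R[i]^o _ _ _ FF); case: ifP => [Ewu|nE].
  exists [fset (exist _ u Ewu : Chi E w)]%fset => // F /= /fsubsetP uF.
  rewrite /partial_sum.
  rewrite -(big_seq_fsetE _ _ xpredT (fun u' => lambda (val u') * c0_delta u (val u'))).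
  rewrite (big_fsetD1 (exist _ u Ewu))/=; last by rewrite uF// inE.
  rewrite eqxx mulr1 big_seq big1 ?addr0// => u'.
  rewrite !inE => /andP[u'u _]; apply: delta0; apply: contra_neq u'u => u'u.
  exact: val_inj.
apply: nearW => F; rewrite /partial_sum big1// => u' _; apply: delta0.
by apply: contraFneq nE => <-; exact: (valP (val u')).
Qed.

End Shift.

Section TreeShift.
Context {R : realType} {A : countType} (E : rel A) (lambda : A -> R[i]).
Context (T : {linear c0 R A -> c0 R A}).
Context (tree_E : directed_tree E) (lambda_neq0 : forall v, lambda v != 0).
Context (shift_T : is_weighted_backward_shift E lambda T).

Lemma shift_child v u : E v u -> T (c0_delta u) = lambda u *: c0_delta v.
Proof.
move=> vu; apply: c0_eq => w; rewrite (shift_delta shift_T) c0_scaleE c0_deltaE.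
have [->|wv] := eqVneq w v; first by rewrite vu mulr1.
case: ifP => [wu|_]; last by rewrite mulr0.
by case/eqP: wv; exact: (parent_unique tree_E) wu vu.
Qed.

Lemma shift_root r : (forall a, ~~ E a r) -> T (c0_delta r) = 0.
Proof.
by move=> rE; apply: c0_eq => w; rewrite (shift_delta shift_T) (negPf (rE w)).
Qed.

(** Propagated along an undirected path from the root: going down to a child costs
one more iterate; going up to a parent is possible because the weights do not
vanish. *)
Lemma shift_nil : rooted E -> forall u, exists n, iter n T (c0_delta u) = 0.
Proof.
move=> [r rE] u; have [p [rp <-]] := tree_connected tree_E r u.
have : exists n, iter n T (c0_delta r) = 0 by exists 1%N; exact: shift_root.
elim: p r rp {rE u} => //= b p IHp r /andP[rb bp] [n nr]; apply: (IHp _ bp).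
case/orP: rb => [rb|br].
  by exists n.+1; rewrite iterSr (shift_child rb) linearZ/= nr scaler0.
exists n; apply/eqP; have : iter n.+1 T (c0_delta r) == 0 by rewrite iterS nr linear0.
rewrite iterSr (shift_child br) linearZ/= scaler_eq0.
by rewrite (negPf (lambda_neq0 r)).
Qed.

Lemma tree_shiftlike : rooted E -> bounded_operator T ->
  exists M, shiftlike T M.
Proof.
move=> rE [M TM]; exists (`|M| + 1); split.
- by rewrite lerDr.
- move=> f; apply: le_trans (_ : `|M| * `|f| <= _); last first.
    by rewrite ler_wpM2r// lerDl.
  have TM0 : 0 <= M * `|f| by apply: le_trans (TM f).
  by rewrite -[X in _ <= _ * X]normr_id -normrM ger0_norm.
- move=> u; have [[v vu]|nE] := pselect (exists v, E v u).
    by exists (lambda u), v; exact: shift_child.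
  exists 0, u; rewrite scale0r; apply: shift_root => v.
  by apply/negP => vu; apply: nE; exists v.
- exact: shift_nil.
Qed.

End TreeShift.

Theorem theorem3p3 (R : realType) (A : countType) (E : rel A)
    (lambda : A -> R[i]) (B : c0 R A -> c0 R A)
    (tree_E : directed_tree E) (rooted_E : rooted E) (leafless_E : leafless E)
    (lambda_neq0 : forall v, lambda v != 0)
    (shift_B : is_weighted_backward_shift E lambda B)
    (bounded_B : bounded_operator B) :
  (hypercyclic B <-> exists S, hypercyclic_algebra B S) /\
  (hypercyclic B <->
    exists S, [/\ hypercyclic_algebra B S, dense S &
                 countably_generated_free S]).
Proof.
have alg_hyp S : hypercyclic_algebra B S -> hypercyclic B.
  move=> [[S0 _ _ _] SN0 Shyp].
  have [f [Sf f0]] : exists f, S f /\ f != 0.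
    apply: contrapT => nf; case/eqP: SN0; apply/seteqP; split=> [f Sf|_ ->//].
    by apply: contrapT => /eqP f0; apply: nf; exists f.
  by exists f; case: (Shyp f Sf) => // /eqP; rewrite (negPf f0).
have hyp_free : hypercyclic B -> exists S, [/\ hypercyclic_algebra B S, dense S &
                 countably_generated_free S].
  have [r _] := rooted_E.
  pose T : {linear c0 R A -> c0 R A} :=
    HB.pack B (GRing.isLinear.Build _ _ _ _ B (shift_linear shift_B)).
  have [M slT] := tree_shiftlike (T := T) tree_E lambda_neq0 shift_B rooted_E bounded_B.
  exact: (hypercyclic_free_algebra r slT).
split; split.
- by move=> /hyp_free[S [SB _ _]]; exists S.
- by move=> [S /alg_hyp].
- exact: hyp_free.
- by move=> [S [/alg_hyp]].
Qed.
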